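(* Let $K/F$ be a (possibly infinite) Galois extension of formally real fields which is totally positive. Then the extension $K_{\rm py}/F_{\rm py}$ of pythagorean closures is totally positive.
   Context: A field $F$ is formally real if $-1$ is not a sum of squares in $F$. A semiordering of a field $F$ is a subset $S\subset F$ with $1\in S$, $F^2S\subset S$ (where $F^2=\{x^2:x\in F\}$), $S+S\subset S$, $S\cup -S=F$ and $S\cap -S=\{0\}$. A field extension $K/F$ is totally positive if every semiordering $S$ of $F$ extends to a semiordering $S'$ of $K$ (i.e. $S'\cap F=S$). A field is pythagorean if every sum of squares in it is a square. All algebraic extensions of $F$ are taken inside a fixed algebraic closure $F_{\rm al}$ of $F$. The pythagorean closure $F_{\rm py}$ of $F$ is the smallest pythagorean subfield of $F_{\rm al}$ containing $F$; equivalently, it is the compositum of all fields $L\subset F_{\rm al}$ for which there is a tower $F=L_0\subset L_1\subset\cdots\subset L_n=L$ with $L_{i+1}=L_i(\sqrt{1+a_i^2})$, $a_i\in L_i$. The field $K_{\rm py}$ is defined in the same way for $K$, and $F_{\rm py}\subset K_{\rm py}$. *)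

(* Defs.v *)
(* All fields in play are subfields, given as sets, of one ambient field [L]. *)
From mathcomp Require Import all_boot all_order all_algebra all_field.
From mathcomp Require Import boolp classical_sets.

Set Implicit Arguments.
Unset Strict Implicit.
Unset Printing Implicit Defensive.

Import GRing.Theory.
Local Open Scope ring_scope.
Local Open Scope classical_set_scope.

Section Subfields.
Variable L : fieldType.
Implicit Types (E A B S : set L).

Definition subfield E : Prop := GRing.divring_closed [in E].

Definition sum_of_squares E (x : L) : Prop :=
  exists s : seq L, (forall y, y \in s -> E y) /\ x = \sum_(y <- s) y ^+ 2.

Definition formally_real E : Prop := ~ sum_of_squares E (-1).

Definition pythagorean E : Prop :=
  forall x, sum_of_squares E x -> exists2 y, E y & x = y ^+ 2.

Definition semiordering E S : Prop :=
  [/\ S `<=` E,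
      S 1,
      (forall a x, E a -> S x -> S (a ^+ 2 * x)),
      (forall x y, S x -> S y -> S (x + y)) &
      S `|` -%R @` S = E /\ S `&` -%R @` S = [set 0]].

(* The extension [B / A] of subfields of [L] with [A `<=` B]. *)
Definition totally_positive A B : Prop :=
  forall S, semiordering A S ->
    exists S', semiordering B S' /\ S' `&` A = S.

(* [smallest] is an intersection; it is itself a pythagorean subfield when [L]
   is algebraically closed, see [pyclosure_subfield] and
   [pyclosure_pythagorean]. *)
Definition pyclosure E : set L :=
  smallest [set M | subfield M /\ pythagorean M] E.

End Subfields.

Section Galois.
Variables (F L : fieldType) (iota : {rmorphism F -> L}).

(* [K] is a Galois extension of [iota F]: algebraic, normal and separable,
   without any finiteness. *)
Definition galois_ext (K : set L) : Prop :=
  [/\ range iota `<=` K,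
      (forall x, K x -> algebraicOver iota x),
      (forall (p : {poly F}) (x : L),
         irreducible_poly p -> K x -> root (map_poly iota p) x ->
         exists2 rs : seq L, (forall r, r \in rs -> K r) &
           map_poly iota p %= \prod_(r <- rs) ('X - r%:P)) &
      (forall (p : {poly F}) (x : L),
         irreducible_poly p -> K x -> root (map_poly iota p) x ->
         separable_poly p)].

End Galois.

Lemma pyclosure_subfield (L : fieldType) (E : set L) : subfield (pyclosure E).
Proof.
split=> [|x y|x y]; rewrite !inE.
- by move=> M [[[M1 _ _] _] _]; have := M1; rewrite !inE.
- move=> Ex Ey M EM; have [[[_ MB _] _] _] := EM.
  by have := MB x y; rewrite !inE; apply; [exact: Ex | exact: Ey].
- move=> Ex Ey M EM; have [[[_ _ MV] _] _] := EM.
  by have := MV x y; rewrite !inE; apply; [exact: Ex | exact: Ey].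
Qed.

Lemma pyclosure_pythagorean (L : closedFieldType) (E : set L) :
  pythagorean (pyclosure E).
Proof.
move=> x [s [sE xE]].
have [y yx] : exists y : L, y ^+ 2 = x.
  have [|y] := @solve_monicpoly L 2 (fun i => if i == 0 then x else 0) => //.
  by rewrite !big_ord_recl big_ord0 /= expr0 mulr1 mul0r !addr0 => yx; exists y.
exists y => // M EM; have [[fM pM] _] := EM.
have [|z Mz xz] := pM x; first by exists s; split=> // t /sE; apply.
have /eqP := etrans yx xz; rewrite eqf_sqr => /orP[/eqP->//|/eqP->].
have [M1 MB _] := fM.
have := MB z z; have := MB (z - z) z; rewrite !inE subrr sub0r => h1 h2.
by apply: h1 => //; apply: h2.
Qed.

(* Main.v *)
(* Let [S] be a semiordering of [F_py].  By Zorn there is a maximal subfield [M]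
   of [Fal] containing [F_py] in which [-1] is not of the form
   [\sum_i s_i m_i ^+ 2] with [s_i] in [S]; it suffices to show [K_py `<=` M].
   Maximality makes [M] pythagorean and, by the argument of Springer's
   theorem, makes every polynomial of odd degree over [M] have a root in [M]; so
   it remains to prove [K `<=` M].  This follows from Laplace's proof of the
   fundamental theorem of algebra once every [y] in [K] with [y ^+ 2] in [M] is
   known to lie in [M], i.e. once such a [y ^+ 2] is a sum of squares in [M].
   Let [r] range over the conjugates of [y] over [F]; they all lie in [K].  For
   [Y] in [F[X]] the Hermite form [\sum_r Y(r) ^+ 2] is a sum of squares in [K]
   lying in [F], so it is a sum of squares in [F] because [K / F] is totally
   positive.  Hence its values at [Y] in [M[X]] are sums of squares in [M],
   and a suitable [Y] gives a positive integral multiple of [y ^+ 2]. *)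
Require Import Defs.
From HB Require Import structures.
From mathcomp Require Import all_boot all_order all_algebra all_field.
From mathcomp Require Import boolp classical_sets.
From mathcomp Require Import perm ring zify.
From mathcomp Require mpoly.

Set Implicit Arguments.
Unset Strict Implicit.
Unset Printing Implicit Defensive.

Import GRing.Theory.
Local Open Scope ring_scope.
Local Open Scope classical_set_scope.

(** * Subfields as field types *)

Section SubfieldType.
Variables (L : fieldType) (E : set L) (fE : subfield E).

(** The proof of [subfield E] is an argument of the predicate so that instance inference can recover
    it. *)
Definition in_subfield of subfield E : pred L := fun x => x \in E.

HB.instance Definition _ :=
  GRing.isDivringClosed.Build L (in_subfield fE) fE.

Record subfield_type := SubfieldType {
  subfield_val :> L;
  _ : in_subfield fE subfield_val
}.

HB.instance Definition _ := [isSub for subfield_val].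
HB.instance Definition _ := [Choice of subfield_type by <:].
HB.instance Definition _ :=
  [SubChoice_isSubIntegralDomain of subfield_type by <:].
HB.instance Definition _ :=
  [SubIntegralDomain_isSubField of subfield_type by <:].

End SubfieldType.

(** Polynomials need a field type of coefficients; this allows a subfield to be replaced by
    [range j] for a morphism [j] from such a type. *)
Lemma subfieldP (L : fieldType) (E : set L) : subfield E ->
  exists (A : fieldType) (j : {rmorphism A -> L}), E = range j.
Proof.
move=> fE; exists (subfield_type fE), (val : {rmorphism _ -> _}).
apply/seteqP; split=> [x Ex|_ [[x xE] _ <-]].
  by exists (SubfieldType (mem_set Ex : in_subfield fE x)).
exact: set_mem xE.
Qed.

Lemma subfield_range (A : fieldType) (L : fieldType) (j : {rmorphism A -> L}) :
  subfield (range j).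
Proof.
split=> [|x y|x y]; rewrite ?inE.
- by exists 1; rewrite ?rmorph1.
- by case=> a _ <- [b _ <-]; exists (a - b); rewrite ?rmorphB.
- by case=> a _ <- [b _ <-]; exists (a / b); rewrite ?fmorph_div.
Qed.

(** * Closure properties of subfields *)

Section SubfieldTheory.
Variables (L : fieldType) (E : set L).
Hypothesis fE : subfield E.
Implicit Types x y : L.

Lemma subfield1 : E 1.
Proof. by have [E1 _ _] := fE; exact: set_mem E1. Qed.

Lemma subfieldB x y : E x -> E y -> E (x - y).
Proof.
move=> /mem_set Ex /mem_set Ey; have [_ EB _] := fE;
  exact: set_mem (EB _ _ Ex Ey).
Qed.

Lemma subfield_div x y : E x -> E y -> E (x / y).
Proof.
move=> /mem_set Ex /mem_set Ey; have [_ _ EV] := fE;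
  exact: set_mem (EV _ _ Ex Ey).
Qed.

Lemma subfield0 : E 0.
Proof. by rewrite -(subrr 1); apply: subfieldB; exact: subfield1. Qed.

Lemma subfieldN x : E x -> E (- x).
Proof. by rewrite -sub0r; apply: subfieldB; exact: subfield0. Qed.

Lemma subfieldD x y : E x -> E y -> E (x + y).
Proof. by move=> Ex Ey; rewrite -(opprK y); apply/subfieldB/subfieldN. Qed.

Lemma subfieldV x : E x -> E x^-1.
Proof. by rewrite -div1r; apply: subfield_div; exact: subfield1. Qed.

Lemma subfieldM x y : E x -> E y -> E (x * y).
Proof. by move=> Ex Ey; rewrite -(invrK y); apply/subfield_div/subfieldV. Qed.

Lemma subfieldX x n : E x -> E (x ^+ n).
Proof.
move=> Ex; elim: n => [|n IHn]; first by rewrite expr0; exact: subfield1.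
by rewrite exprS; exact: subfieldM.
Qed.

Lemma subfield_nat n : E n%:R.
Proof.
elim: n => [|n IHn]; first exact: subfield0.
by rewrite -addn1 natrD; apply: subfieldD => //; exact: subfield1.
Qed.

Lemma subfield_sum (I : eqType) (r : seq I) (f : I -> L) :
  (forall i, i \in r -> E (f i)) -> E (\sum_(i <- r) f i).
Proof.
move=> Ef; rewrite big_seq; elim/big_ind: _ => //; first exact: subfield0.
exact: subfieldD.
Qed.

End SubfieldTheory.

(** * Zorn's lemma above a given set, and unions of chains *)

Lemma zorn_above (T : Type) (P : set (set T)) (Q : set T) :
  P Q ->
  (forall C : set (set T), C `<=` P -> C !=set0 ->
    (forall X, C X -> Q `<=` X) -> total_on C subset ->
    P (\bigcup_(X in C) X)) ->
  exists M, [/\ P M, Q `<=` M & forall N, P N -> M `<=` N -> N `<=` M].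
Proof.
move=> PQ Pch.
(* Joining [Q] to every member also settles the empty chain, whose union becomes [Q] itself. *)
have [C CP totC|A [PA maxA]] := @Zorn_bigcup T [set X | P (Q `|` X)].
  have [->|/set0P[X0 CX0]] := eqVneq C set0.
    by rewrite /= bigcup_set0 setU0.
  have -> : [set X | P (Q `|` X)] (\bigcup_(X in C) X) =
      P (\bigcup_(X in [set Q `|` X | X in C]) X).
    congr P; apply/seteqP; split=> x.
      case=> [Qx|[X CX Xx]]; first by exists (Q `|` X0); [exists X0|left].
      by exists (Q `|` X); [exists X|right].
    by case=> _ [X CX <-] [Qx|Xx]; [left|right; exists X].
  apply: Pch.
  - by move=> _ [X CX <-]; exact: CP.
  - by exists (Q `|` X0), X0.
  - by move=> _ [X CX <-] x Qx; left.
  - move=> _ _ [X CX <-] [Y CY <-].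
    by have [XY|YX] := totC _ _ CX CY; [left|right]; exact: setUS.
exists (Q `|` A); split=> [//|x|N PN QAN x Nx]; first by left.
apply: contrapT => nQAx; apply: (maxA N).
  split=> [y Ay|NA]; first by apply: QAN; right.
  by apply: nQAx; right; exact: NA.
rewrite /=; suff -> : Q `|` N = N by [].
by apply/seteqP; split=> [y [Qy|//]|y]; [apply: QAN; left|right].
Qed.

(** Lets a computation with finitely many elements of the union take place inside one member of the
    chain. *)
Lemma chain_seq (T : eqType) (C : set (set T)) (s : seq T) :
  C !=set0 -> total_on C subset ->
  (forall x, x \in s -> (\bigcup_(X in C) X) x) ->
  exists2 X, C X & forall x, x \in s -> X x.
Proof.
move=> [X0 CX0] totC; elim: s => [|x s IHs] sC; first by exists X0.
have [|X CX sX] := IHs; first by move=> y ys; apply: sC; rewrite inE ys orbT.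
have [|Y CY Yx] := sC x; first by rewrite mem_head.
have [XY|YX] := totC _ _ CX CY.
  by exists Y => // z; rewrite inE => /orP[/eqP->//|/sX/XY].
by exists X => // z; rewrite inE => /orP[/eqP->//|/sX//]; exact: YX.
Qed.

(** * Quadratic modules and semiorderings *)

Section QModules.
Variable L : fieldType.
Implicit Types (A B E Q S : set L) (x y : L).

(** Proper quadratic modules: no closure under products is asked, and the semiorderings are exactly
    the maximal ones. *)
Definition qmodule E Q : Prop :=
  [/\ Q `<=` E, Q 1,
      (forall a x, E a -> Q x -> Q (a ^+ 2 * x)),
      (forall x y, Q x -> Q y -> Q (x + y)) &
      ~ Q (-1)].

(** For [S] inside a subfield [B] and containing 1, this is the quadratic module of [B] generated by
    [S], allowed to contain [-1]. *)
Definition qspan S B x : Prop :=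
  exists t : seq (L * L), (forall u, u \in t -> S u.1 /\ B u.2) /\
    x = \sum_(u <- t) u.1 * u.2 ^+ 2.

Lemma qspan_mul S B x y : S x -> B y -> qspan S B (x * y ^+ 2).
Proof.
move=> Sx By; exists [:: (x, y)]; rewrite big_seq1; split=> // u.
by rewrite inE => /eqP->.
Qed.

Lemma sub_qspan S B : subfield B -> S `<=` qspan S B.
Proof.
move=> fB x Sx; rewrite -(mulr1 x) -(expr1n _ 2).
by apply: qspan_mul => //; exact: subfield1.
Qed.

Lemma qspanD S B x y : qspan S B x -> qspan S B y -> qspan S B (x + y).
Proof.
move=> [s [sP ->]] [t [tP ->]]; exists (s ++ t); rewrite big_cat; split=> // u.
by rewrite mem_cat => /orP[/sP|/tP].
Qed.

Lemma qspan_sqr S B a x : subfield B -> B a -> qspan S B x ->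
  qspan S B (a ^+ 2 * x).
Proof.
move=> fB Ba [t [tP ->]]; exists [seq (u.1, a * u.2) | u <- t]; split.
  by move=> _ /mapP[u /tP[Su Bu] ->]; split=> //; exact: subfieldM.
by rewrite big_map mulr_sumr; apply: eq_bigr => u _ /=; rewrite exprMn mulrCA.
Qed.

Lemma qspanS S A B : A `<=` B -> qspan S A `<=` qspan S B.
Proof.
by move=> AB x [t [tP ->]]; exists t; split=> // u /tP[Su /AB].
Qed.

Lemma qspan_qmodule S B : subfield B -> S `<=` B -> S 1 ->
  ~ qspan S B (-1) -> qmodule B (qspan S B).
Proof.
move=> fB SB S1 nS; split=> //; first 1 last.
- exact: sub_qspan.
- by move=> a x; exact: qspan_sqr.
- by move=> x y; exact: qspanD.
move=> x [t [tP ->]]; apply: subfield_sum => // u /tP[/SB Bu1 Bu2].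
by apply: subfieldM => //; exact: subfieldX.
Qed.

Lemma qmodule0 E Q : subfield E -> qmodule E Q -> Q 0.
Proof.
move=> fE [_ Q1 QM _ _]; have := QM _ _ (subfield0 fE) Q1.
by rewrite expr0n mul0r.
Qed.

Lemma sub_qspanT S Q B : subfield B -> qmodule B Q -> S `<=` Q ->
  qspan S B `<=` Q.
Proof.
move=> fB qQ SQ; have [_ _ QM QD _] := qQ => x [t [tP ->]].
rewrite big_seq; elim/big_ind: _ => //.
  exact: qmodule0 qQ.
by move=> u /tP[/SQ Qu Bu]; rewrite mulrC; exact: QM.
Qed.

Lemma qmodule_nat E Q n : subfield E -> qmodule E Q -> Q n%:R.
Proof.
move=> fE qQ; have [_ Q1 _ QD _] := qQ; elim: n => [|n IHn].
  exact: qmodule0 qQ.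
by rewrite -addn1 natrD; exact: QD.
Qed.

(** A vanishing [n.+1%:R] would put [-1 = n%:R] in [Q]; this is how characteristic 0 is obtained. *)
Lemma qmodule_natf_neq0 E Q n : subfield E -> qmodule E Q -> n.+1%:R != 0 :> L.
Proof.
move=> fE qQ; have [_ _ _ _ nQ] := qQ; apply: contra_notN nQ.
by rewrite -addn1 natrD addr_eq0 => /eqP <-; exact: qmodule_nat qQ.
Qed.

Lemma qmodule_cap_opp E Q x : subfield E -> qmodule E Q ->
  Q x -> Q (- x) -> x = 0.
Proof.
move=> fE qQ; have n2 := qmodule_natf_neq0 1 fE qQ.
have [QE _ QM QD nQ] := qQ => Qx Qnx.
apply: contrapT => /eqP x0; apply: nQ; have Ex := QE _ Qx.
have Ey c : E c -> E ((- x^-1 + c) / 2%:R).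
  move=> Ec; apply: subfield_div (subfield_nat _ _) => //.
  by apply: subfieldD => //; apply: subfieldN => //; exact: subfieldV.
(* -1 = x y with y = -1/x a difference of two squares *)
have -> : -1 = ((- x^-1 + 1) / 2%:R) ^+ 2 * x +
               ((- x^-1 + -1) / 2%:R) ^+ 2 * - x by field; apply/andP.
apply: QD; apply: QM => //; apply: Ey; last apply: subfieldN => //.
  exact: subfield1.
exact: subfield1.
Qed.

Lemma sum_of_squaresD E x y :
  sum_of_squares E x -> sum_of_squares E y -> sum_of_squares E (x + y).
Proof.
move=> [s [sE ->]] [t [tE ->]]; exists (s ++ t); rewrite big_cat; split=> // z.
by rewrite mem_cat => /orP[/sE|/tE].
Qed.

Lemma sum_of_squares_sqrM E a x : subfield E -> E a ->
  sum_of_squares E x -> sum_of_squares E (a ^+ 2 * x).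
Proof.
move=> fE Ea [s [sE ->]]; exists [seq a * y | y <- s]; split.
  by move=> _ /mapP[y /sE Ey ->]; exact: subfieldM.
by rewrite big_map mulr_sumr; apply: eq_bigr => y _; rewrite exprMn.
Qed.

Lemma sum_of_squares_sqr E a : E a -> sum_of_squares E (a ^+ 2).
Proof.
by move=> Ea; exists [:: a]; rewrite big_seq1; split=> // y;
  rewrite inE => /eqP->.
Qed.

Lemma sum_of_squares0 E : sum_of_squares E 0.
Proof. by exists [::]; rewrite big_nil. Qed.

Lemma sum_of_squares1 E : subfield E -> sum_of_squares E 1.
Proof.
by move=> fE; rewrite -(expr1n _ 2); apply: sum_of_squares_sqr;
  exact: subfield1.
Qed.

Lemma sum_of_squares_sub E x : subfield E -> sum_of_squares E x -> E x.
Proof.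
by move=> fE [s [sE ->]]; apply: subfield_sum => // y /sE Ey; exact: subfieldX.
Qed.

Lemma sum_of_squaresS A B : A `<=` B -> sum_of_squares A `<=` sum_of_squares B.
Proof. by move=> AB x [s [sE ->]]; exists s; split=> // y /sE/AB. Qed.

Lemma sum_of_squares_qmodule E : subfield E -> formally_real E ->
  qmodule E (sum_of_squares E).
Proof.
move=> fE rE; split=> //; first by move=> x; exact: sum_of_squares_sub.
- exact: sum_of_squares1.
- by move=> a x; exact: sum_of_squares_sqrM.
- exact: sum_of_squaresD.
Qed.

Lemma qmodule_sosM E Q c x : subfield E -> qmodule E Q ->
  sum_of_squares E c -> Q x -> Q (c * x).
Proof.
move=> fE qQ [s [sE ->]] Qx; have [_ _ QM QD _] := qQ.
rewrite mulr_suml big_seq; elim/big_ind: _ => //; first exact: qmodule0 qQ.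
by move=> y /sE Ey; exact: QM.
Qed.

(** If [-1 = y + c * x] with [c] nonzero, then [- x] is a square times [c * (1 + y)], where [c] is a
    sum of squares and [1 + y] is in [Q]; so [- x] would lie in [Q]. *)
Lemma qmodule_adjoin E Q x : subfield E -> qmodule E Q -> E x -> ~ Q (- x) ->
  qmodule E [set z | exists y c, [/\ Q y, sum_of_squares E c & z = y + c * x]].
Proof.
move=> fE qQ Ex nx; have [QE Q1 QM QD nQ] := qQ.
split=> [_ [y [c [/QE Ey Ec ->]]]| |b _ Eb [y [c [Qy Ec ->]]]| |].
- by apply: subfieldD => //; apply: subfieldM => //; exact: sum_of_squares_sub.
- by exists 1, 0; rewrite mul0r addr0; split=> //; exact: sum_of_squares0.
- exists (b ^+ 2 * y), (b ^+ 2 * c); rewrite mulrDr mulrA; split=> //.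
    exact: QM.
  exact: sum_of_squares_sqrM.
- move=> _ _ [y [c [Qy Ec ->]]] [z [d [Qz Ed ->]]].
  exists (y + z), (c + d); rewrite mulrDl addrACA; split=> //; first exact: QD.
  exact: sum_of_squaresD.
move=> [y [c [Qy Ec h]]]; have [c0|c0] := eqVneq c 0.
  by apply: nQ; rewrite h c0 mul0r addr0.
apply: nx; have -> : - x = (c^-1) ^+ 2 * (c * (1 + y)).
  have -> : 1 + y = - (c * x) by rewrite -[1]opprK h opprD addrAC addNr add0r.
  by field.
apply: QM; first by apply: subfieldV => //; exact: sum_of_squares_sub.
exact: qmodule_sosM fE qQ Ec (QD _ _ Q1 Qy).
Qed.

(** A maximal module [S] is total, since by [qmodule_adjoin] any [x] with [- x] outside [S] can be
    added; [qmodule_cap_opp] makes it antisymmetric. *)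
Lemma qmodule_semiordering E Q : subfield E -> qmodule E Q ->
  exists2 S, semiordering E S & Q `<=` S.
Proof.
move=> fE qQ; have [C Cq [X0 CX0] QC totC|S [qS QS maxS]] :=
  @zorn_above _ (qmodule E) Q qQ.
  split.
  - by move=> x [X CX]; have [XE _ _ _ _] := Cq _ CX; exact: XE.
  - by exists X0 => //; have [_ X1 _ _ _] := Cq _ CX0.
  - by move=> a x Ea [X CX Xx]; exists X => //; have [_ _ + _ _] := Cq _ CX;
      apply.
  - move=> x y [X CX Xx] [Y CY Yy]; have [XY|YX] := totC _ _ CX CY.
      by exists Y => //; have [_ _ _ + _] := Cq _ CY; apply=> //; exact: XY.
    by exists X => //; have [_ _ _ + _] := Cq _ CX; apply=> //; exact: YX.
  - by move=> [X CX]; have [_ _ _ _] := Cq _ CX.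
exists S => //; have [SE S1 SM SD nS] := qS; split=> //; split.
  apply/seteqP; split=> [x [/SE//|[y /SE Ey <-]]|x Ex]; first exact: subfieldN.
  have [Snx|nSnx] := pselect (S (- x)).
    by right; exists (- x) => //; rewrite opprK.
  left; apply: (maxS _ (qmodule_adjoin fE qS Ex nSnx)).
    move=> y Sy; exists y, 0; rewrite mul0r addr0; split=> //.
    exact: sum_of_squares0.
  exists 0, 1; rewrite add0r mul1r; split=> //; first exact: qmodule0 qS.
  exact: sum_of_squares1.
apply/seteqP; split=> [x [Sx [y Sy yx]]|_ ->] /=.
  by apply: (qmodule_cap_opp fE qS Sx); rewrite -yx opprK.
have S0 := qmodule0 fE qS.
by split=> //; exists 0 => //; rewrite oppr0.
Qed.

Lemma semiordering_qmodule E S : subfield E -> semiordering E S -> qmodule E S.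
Proof.
move=> fE [SE S1 SM SD [_ S0]]; split=> // Sn1.
have : (S `&` -%R @` S) 1 by split=> //; exists (-1); rewrite ?opprK.
by rewrite S0 => /eqP; rewrite oner_eq0.
Qed.

Lemma semiordering_total E S x : semiordering E S -> E x -> S x \/ S (- x).
Proof.
move=> [_ _ _ _ [<- _]] [Sx|[y Sy <-]]; first by left.
by right; rewrite opprK.
Qed.

(** Any semiordering above [qspan S B] restricts to [S]: an [x] of [A] outside [S] has [- x] in [S],
    and having both signs in the extension forces [x = 0]. *)
Lemma semiordering_ext A B S : subfield A -> subfield B -> A `<=` B ->
  semiordering A S -> ~ qspan S B (-1) ->
  exists S', semiordering B S' /\ S' `&` A = S.
Proof.
move=> fA fB AB sS nS; have qS := semiordering_qmodule fA sS.
have [SA S1 _ _ _] := qS.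
have [||S' sS' SS'] := @qmodule_semiordering B (qspan S B).
- exact: fB.
- by apply: qspan_qmodule => // x /SA/AB.
have {}SS' : S `<=` S' by move=> x Sx; apply: SS'; exact: sub_qspan.
exists S'; split=> //; apply/seteqP; split=> [x [S'x Ax]|x Sx]; last first.
  by split; [exact: SS'|exact: SA].
have [//|Snx] := semiordering_total sS Ax.
have -> : x = 0.
  by apply: (qmodule_cap_opp fB (semiordering_qmodule fB sS')) => //;
    exact: SS'.
exact: qmodule0 qS.
Qed.

(** An expression of [-1] in [qspan] involves finitely many elements of the union of a chain, hence
    already occurs over one member. *)
Lemma max_subfield A S : subfield A -> ~ qspan S A (-1) ->
  exists M, [/\ subfield M, A `<=` M, ~ qspan S M (-1) &
    forall N, subfield N -> ~ qspan S N (-1) -> M `<=` N -> N `<=` M].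
Proof.
move=> fA nA.
have [//|C CP [X0 CX0] AC totC|M [[fM nM] AM maxM]] :=
  @zorn_above _ [set M | subfield M /\ ~ qspan S M (-1)] A.
  have chain (s : seq L) : (forall x, x \in s -> (\bigcup_(X in C) X) x) ->
      exists2 X, C X & forall x, x \in s -> X x.
    by apply: chain_seq => //; exists X0.
  have op (f : L -> L -> L) :
      (forall X x y, C X -> X x -> X y -> X (f x y)) ->
      forall x y, (\bigcup_(X in C) X) x -> (\bigcup_(X in C) X) y ->
        (\bigcup_(X in C) X) (f x y).
    move=> fX x y Cx Cy; have [|X CX sX] := chain [:: x; y].
      by move=> z; rewrite !inE => /orP[]/eqP->.
    by exists X => //; apply: fX => //; apply: sX; rewrite !inE eqxx ?orbT.
  split; first split=> [|x y|x y]; rewrite ?inE.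
  - by exists X0 => //; have [fX _] := CP _ CX0; exact: subfield1.
  - by move=> Cx Cy; apply: (op (fun x y => x - y)) Cx Cy =>
      X u v /CP[fX _] Xu Xv; exact: subfieldB.
  - by move=> Cx Cy; apply: (op (fun x y => x / y)) Cx Cy =>
      X u v /CP[fX _] Xu Xv; exact: subfield_div.
  move=> [t [tP h]]; have [|X CX sX] := chain [seq u.2 | u <- t].
    by move=> _ /mapP[u /tP[_ Cu] ->].
  have [_ nX] := CP _ CX; apply: nX; exists t; split=> // u ut.
  by have [Su _] := tP _ ut; split=> //; apply/sX/map_f.
by exists M; split=> // N fN nN; exact: maxM.
Qed.

End QModules.

(** * Springer's descent for polynomials of odd degree *)

Section Springer.
Variables (A : fieldType) (Q : set A).
Hypothesis qQ : qmodule [set: A] Q.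
Implicit Types (p q : {poly A}) (t : seq (A * {poly A})).

Let fT : subfield [set: A].
Proof. by split=> [|x y|x y]; rewrite !inE. Qed.

(** An odd size means a nonzero polynomial of even degree. *)
Let pos p := odd (size p) /\ Q (lead_coef p).

(** When the sizes agree the leading coefficients cannot cancel, since [Q] meets its opposite only
    in 0. *)
Let posD p q : pos p -> pos q -> pos (p + q).
Proof.
have [_ _ _ QD _] := qQ; move=> [op Qp] [oq Qq].
have [pq|qp|pq] := ltngtP (size p) (size q).
- by split; [rewrite addrC size_polyDl|rewrite lead_coefDr].
- by split; [rewrite size_polyDl|rewrite lead_coefDl].
have q0 : lead_coef q != 0.
  by rewrite lead_coef_eq0 -size_poly_eq0; case: (size q) oq.
have lcE : (p + q)`_(size p).-1 = lead_coef p + lead_coef q.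
  by rewrite coefD {2}pq !lead_coefE.
have pq0 : lead_coef p + lead_coef q != 0.
  apply: contra_neqN q0 => /eqP/addr0_eq h.
  by apply: (qmodule_cap_opp fT qQ) => //; rewrite -h opprK.
have szD : size (p + q) = size p.
  apply/eqP; rewrite eqn_leq; apply/andP; split.
    by rewrite (leq_trans (size_polyD _ _)) // pq maxnn.
  rewrite leqNgt; apply: contraNN pq0; rewrite -lcE => szpq.
  by rewrite nth_default // -ltnS (ltn_predK szpq).
by rewrite /pos lead_coefE szD lcE; split=> //; exact: QD.
Qed.

Let pos_sum t : (forall u, u \in t -> Q u.1) ->
  pos (1 + \sum_(u <- t) u.1 *: u.2 ^+ 2).
Proof.
have [_ Q1 QM _ _] := qQ; elim: t => [|u t IHt] tQ.
  by rewrite big_nil addr0 /pos size_poly1 lead_coef1.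
have [|ot Qt] := IHt; first by move=> v vt; apply: tQ; rewrite inE vt orbT.
rewrite big_cons addrCA; have [->|u10] := eqVneq u.1 0.
  by rewrite scale0r add0r.
have [->|u20] := eqVneq u.2 0; first by rewrite expr0n scaler0 add0r.
apply: posD => //; split.
  rewrite size_scale // expr2 size_mul //.
  move: u20; rewrite -size_poly_gt0; case: (size u.2) => // k _.
  by rewrite addnS /= ?addSn ?oddS addnn odd_double.
by rewrite lead_coefZ lead_coef_exp mulrC; apply: QM => //; exact/tQ/mem_head.
Qed.

(* As in Springer's theorem, [size p] being even means that the degree of [p]
   is odd; the degree of the sum is even, so after reducing the [u.2] modulo
   [p] the cofactor of [p] has a smaller odd degree. *)
Lemma odd_degree_ndvd p t : p != 0 -> ~~ odd (size p) ->
  (forall u, u \in t -> Q u.1) -> ~~ (p %| 1 + \sum_(u <- t) u.1 *: u.2 ^+ 2).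
Proof.
have [n] := ubnP (size p); elim: n => // n IHn in p t *.
rewrite ltnS => pn p0 op tQ; apply/negP.
pose t' := [seq (u.1, u.2 %% p) | u <- t].
have t'Q u : u \in t' -> Q u.1 by case/mapP=> v /tQ Qv ->.
have [+ _] := pos_sum t'Q; set f := 1 + _ => of'.
have -> : (p %| 1 + \sum_(u <- t) u.1 *: u.2 ^+ 2) = (p %| f).
  rewrite -(subrK f (1 + _)) dvdp_addr // /f big_map opprD addrACA subrr add0r
    -sumrB.
  elim/big_ind: _ => [||u _]; [exact: dvdp0|exact: dvdp_add|].
  rewrite /= -scalerBr -mul_polyC dvdp_mull // subr_sqr dvdp_mulr //.
  by rewrite {1}(divp_eq u.2 p) addrK dvdp_mull.
move=> /dvdpP[h fE].
have f0 : f != 0 by rewrite -size_poly_eq0; case: (size f) of'.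
have h0 : h != 0 by apply: contraNneq f0 => h0; rewrite fE h0 mul0r.
have p2 : (1 < size p)%N by move: p0; rewrite -size_poly_gt0; lia.
have szf : (size f <= (size p).*2 - 3)%N.
  rewrite (leq_trans (size_polyD _ _)) // geq_max size_poly1.
  apply/andP; split; first lia.
  rewrite big_map; elim/big_ind: _ => [|q r hq hr|u _] /=.
  - by rewrite size_poly0.
  - by rewrite (leq_trans (size_polyD _ _)) // geq_max hq.
  rewrite (leq_trans (size_scale_leq _ _)) // expr2.
  rewrite (leq_trans (size_polyMleq _ _)) //.
  have szm : forall a b, (a < b -> (a + a).-1 <= b.*2 - 3)%N by lia.
  exact: szm (ltn_modpN0 _ p0).
have szE := size_mul h0 p0; rewrite -fE in szE.
suff: ~~ (h %| f) by rewrite fE dvdp_mulr.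
have szh : forall a b c, (a = (b + c).-1 -> a <= c.*2 - 3 -> 1 < c -> c <= n ->
  odd a -> ~~ odd c -> b < n /\ ~~ odd b)%N by lia.
have [hn oh] := szh _ _ _ szE szf p2 pn of' op.
exact: IHn.
Qed.

End Springer.

(** * Simple algebraic extensions *)

Section SimpleExtension.
Variables (A L : fieldType) (j : {rmorphism A -> L}) (g : {poly A}) (z : L).
Hypotheses (irr_g : irreducible_poly g) (gz : root (map_poly j g) z).
Implicit Types p q : {poly A}.

Lemma irreducible_root_dvdp p : root (map_poly j p) z -> g %| p.
Proof.
move=> pz; have [cgp|] := boolP (coprimep g p).
  have := coprimep_root (p := map_poly j g) (q := map_poly j p) (x := z).
  by rewrite coprimep_map => /(_ cgp gz); rewrite (rootP pz) eqxx.
rewrite /coprimep => /irr_g /(_ (dvdp_gcdl _ _)) gg.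
by rewrite -(eqp_dvdl _ gg) dvdp_gcdr.
Qed.

(** A [q] not vanishing at [z] is coprime to the irreducible [g], and its Bezout cofactor [v] gives
    the inverse. *)
Lemma adjoin_subfield : subfield (range (fun p => (map_poly j p).[z])).
Proof.
split=> [|x y|x y]; rewrite ?inE.
- by exists 1 => //; rewrite rmorph1 hornerC.
- by case=> p _ <- [q _ <-]; exists (p - q) => //; rewrite rmorphB !hornerE.
case=> p _ <- [q _ <-]; have [qz|qz] := boolP (root (map_poly j q) z).
  by exists 0 => //; rewrite (rootP qz) invr0 mulr0 rmorph0 horner0.
have : coprimep g q.
  apply: contraNT qz; rewrite /coprimep => /irr_g /(_ (dvdp_gcdl _ _)) gg.
  rewrite -dvdp_XsubCl; move: gz; rewrite -dvdp_XsubCl => /dvdp_trans; apply.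
  by rewrite dvdp_map -(eqp_dvdl _ gg) dvdp_gcdr.
move=> /Bezout_eq1_coprimepP[[u v] /= uv]; exists (p * v) => //.
have /(congr1 (fun h => (map_poly j h).[z])) := uv.
rewrite !(rmorphD, rmorphM) /= !hornerE (rootP gz) mulr0 add0r rmorph1 hornerC.
move=> vq; apply: (mulIf qz).
by rewrite divfK // -mulrA vq mulr1.
Qed.

(** Lifting to polynomials turns a relation for [-1] in the field generated by [z] into a
    divisibility by [g]. *)
Lemma qspan_adjoin S x : S `<=` range j ->
  qspan S (range (fun p => (map_poly j p).[z])) x ->
  exists2 t : seq (A * {poly A}), (forall u, u \in t -> S (j u.1)) &
    x = (map_poly j (\sum_(u <- t) u.1 *: u.2 ^+ 2)).[z].
Proof.
move=> Sj [s [+ ->]] {x}; elim: s => [|[x y] s IHs] sP.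
  by exists [::]; rewrite ?big_nil ?rmorph0 ?horner0.
have [|t tS tE] := IHs; first by move=> u us; apply: sP; rewrite inE us orbT.
have [/= Sx [p _ py]] := sP _ (mem_head _ _); have [a _ ax] := Sj _ Sx.
exists ((a, p) :: t) => [u|].
  by rewrite inE => /orP[/eqP->|/tS//]; rewrite /= ax.
rewrite !big_cons rmorphD hornerD -tE /= map_polyZ rmorphXn !hornerE.
by rewrite py ax.
Qed.

End SimpleExtension.

(** * Properties of the maximal subfield *)

Section MaximalSubfield.
Variables (A : fieldType) (L : closedFieldType) (j : {rmorphism A -> L}).
Variable S : set L.
Hypotheses (Sj : S `<=` range j) (S1 : S 1) (nS : ~ qspan S (range j) (-1)).
Hypothesis maxj : forall N, subfield N -> ~ qspan S N (-1) ->
  range j `<=` N -> N `<=` range j.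

Let fj := subfield_range j.
Let qj := qspan_qmodule fj Sj S1 nS.

(** A root [z] of [g] lies outside [range j], so maximality puts [-1] in the span over the field
    generated by [z]; the lifted relation vanishes at [z]. *)
Lemma max_irreducible (g : {poly A}) : irreducible_poly g ->
  (forall a, ~~ root g a) ->
  exists2 t : seq (A * {poly A}), (forall u, u \in t -> S (j u.1)) &
    g %| 1 + \sum_(u <- t) u.1 *: u.2 ^+ 2.
Proof.
move=> irr_g rg; have [z gz] : exists z, root (map_poly j g) z.
  by apply/closed_rootP; rewrite size_map_poly neq_ltn; case: irr_g => ->;
    rewrite orbT.
have [jz|njz] := pselect (range j z).
  by case: jz gz => a _ <-; rewrite fmorph_root (negPf (rg _)).
have [sp|nsp] := pselect (qspan S (range (fun p => (map_poly j p).[z])) (-1)).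
  have [t tS tE] := qspan_adjoin Sj sp; exists t => //.
  apply: (irreducible_root_dvdp irr_g gz).
  by rewrite rootE rmorphD hornerD -tE rmorph1 hornerC subrr.
case: njz; apply: (maxj (adjoin_subfield irr_g gz) nsp).
  by move=> _ [a _ <-]; exists a%:P; rewrite // map_polyC hornerC.
by exists 'X; rewrite // map_polyX hornerX.
Qed.

(** A polynomial of least odd degree without a root is irreducible, and then [max_irreducible]
    contradicts [odd_degree_ndvd]. *)
Lemma max_odd_root (p : {poly A}) : p != 0 -> ~~ odd (size p) ->
  exists a, root p a.
Proof.
have [n] := ubnP (size p); elim: n => // n IHn in p *.
rewrite ltnS => pn p0 op; apply: contrapT => rp.
have {}rp a : ~~ root p a by apply/negP => pa; apply: rp; exists a.
have p1 : (1 < size p)%N by move: p0 op; rewrite -size_poly_gt0;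
  case: (size p) => [|[]].
have irr_p : irreducible_poly p.
  split=> // q q1 qp; rewrite -dvdp_size_eqp //; apply: contrapT => /negP qp'.
  have [r pE] := dvdpP _ _ qp.
  have /andP[r0 q0] : (r != 0) && (q != 0) by rewrite -negb_or -mulf_eq0 -pE.
  have szp : size p = (size r + size q).-1 by rewrite pE size_mul.
  have noroot f : f %| p -> f != 0 -> ~~ odd (size f) -> (size f < n)%N ->
    False.
    move=> fp f0 of' fn; have [a] := IHn _ fn f0 of'.
    by rewrite -dvdp_XsubCl => /dvdp_trans /(_ fp);
      rewrite dvdp_XsubCl (negPf (rp _)).
  (* In a factorization of a polynomial of odd degree one factor has odd degree; it is smaller
     because neither factor is constant. *)
  have szE : forall a b c, (a = (b + c).-1 -> a <= n -> ~~ odd a ->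
    b != 0 -> c != 0 ->
    c != 1 -> c != a -> (~~ odd c /\ c < n) \/ (~~ odd b /\ b < n))%N by lia.
  have sr : size r != 0%N by rewrite size_poly_eq0.
  have sq : size q != 0%N by rewrite size_poly_eq0.
  have [[oq qn]|[or rn]] := szE _ _ _ szp pn op sr sq q1 qp'.
  - exact: (noroot q).
  - by apply: (noroot r) => //; rewrite pE dvdp_mulr.
have [t tS] := max_irreducible irr_p rp; apply/negP.
apply: (odd_degree_ndvd (Q := j @^-1` qspan S (range j))) => //.
  have [_ Q1 QM QD nQ] := qj; split=> //=; first by rewrite rmorph1.
  - by move=> a x _; rewrite rmorphM rmorphXn; apply: QM; exists a.
  - by move=> x y; rewrite rmorphD; exact: QD.
  - by rewrite rmorphN1.
by move=> u /tS; exact: sub_qspan.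
Qed.

(** If the sum of squares [x] had no square root in [range j], a root [y] of ['X^2 - a%:P] would
    give [-1 = s + w * y]. The cross terms go to [w], and [s] stays in the module because
    [x = y ^+ 2] is a sum of squares. As [y] lies outside [range j], [w = 0] and [-1 = s], which is
    excluded. *)
Lemma max_pythagorean : pythagorean (range j).
Proof.
move=> x sx; have [a _ ax] := sum_of_squares_sub fj sx; apply: contrapT => nx.
have rg b : ~~ root ('X^2 - a%:P) b.
  apply/negP; rewrite rootE !hornerE subr_eq0 => /eqP ba; apply: nx.
  by exists (j b); [exists b|rewrite -ax -ba rmorphXn].
have irr_g : irreducible_poly ('X^2 - a%:P).
  by apply: cubic_irreducible; rewrite // size_XnsubC.
have [t tS] := max_irreducible irr_g rg.
have [y yx] : exists y, y ^+ 2 = x.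
  have /closed_rootP[y] : size ('X^2 - x%:P) != 1 by rewrite size_XnsubC.
  by rewrite rootE !hornerE subr_eq0 => /eqP yx; exists y.
have ny : ~ range j y by move=> jy; apply: nx; exists y.
(* Reduction modulo ['X^2 - a%:P]: higher powers of [y] are absorbed by [y ^+ 2 = x]. *)
have split2 (p : {poly A}) : exists e o, (map_poly j p).[y] = j e + j o * y.
  elim/poly_ind: p => [|p c [e [o pE]]].
    by exists 0, 0; rewrite !rmorph0 horner0 mul0r addr0.
  exists (c + a * o), e; rewrite rmorphD rmorphM /= map_polyX map_polyC
    !hornerE pE.
  by rewrite rmorphD rmorphM /= ax -yx; ring.
have [s [w [ss ws tE]]] : exists s w, [/\ qspan S (range j) s, range j w &
    (map_poly j (\sum_(u <- t) u.1 *: u.2 ^+ 2)).[y] = s + w * y].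
  elim: t tS => [|u t IHt] tS.
    exists 0, 0; rewrite big_nil rmorph0 horner0 mul0r addr0.
    by split=> //; [exact: qmodule0 qj|exact: subfield0].
  have [|s [w [ss [b _ bw] tE]]] := IHt; first by move=> v vt; apply: tS;
    rewrite inE vt orbT.
  have [e [o uE]] := split2 u.2; have Su := tS _ (mem_head _ _).
  exists (j u.1 * j e ^+ 2 + x * (j u.1 * j o ^+ 2) + s).
  exists (j (u.1 * e * o *+ 2 + b)); split.
  - apply: qspanD => //; apply: qspanD; first by apply: qspan_mul => //;
      exists e.
    by apply: (qmodule_sosM fj qj sx); apply: qspan_mul => //; exists o.
  - by exists (u.1 * e * o *+ 2 + b).
  rewrite big_cons [map_poly _ (_ + _)]rmorphD hornerD tE /= map_polyZ rmorphXn.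
  rewrite !hornerE uE -bw -yx.
  by rewrite !(rmorphD, rmorphM, rmorphMn) /=; ring.
move=> /dvdpP[q /(congr1 (fun f => (map_poly j f).[y]))].
rewrite rmorphD rmorphM rmorphB rmorph1 /= map_polyXn map_polyC /= ax !hornerE
  tE yx.
rewrite subrr mulr0 addrA => h; have [w0|w0] := eqVneq w 0.
  by apply: nS; move: h; rewrite w0 mul0r addr0 addrC => /addr0_eq <-;
    rewrite opprK.
apply: ny; have -> : y = - (1 + s) / w.
  by apply: (mulIf w0); rewrite divfK // mulrC; apply/eqP;
    rewrite -addr_eq0 addrC h.
have [sM _ _ _ _] := qj; apply: subfield_div => //; apply: subfieldN => //.
by apply: subfieldD => //; [exact: subfield1|exact: sM].
Qed.

End MaximalSubfield.

(** * Symmetric functions of the roots of a polynomial *)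

Section SymmetricFunctions.
Import mpoly.
Variables (A L : fieldType) (j : {rmorphism A -> L}).

Let fj := subfield_range j.

Lemma map_poly_range (p : {poly L}) : (forall k, range j p`_k) ->
  exists q, p = map_poly j q.
Proof.
move=> pj; have /boolp.choice[a aP] : forall k, exists a, j a = p`_k.
  by move=> k; have [a _ ak] := pj k; exists a.
exists (\poly_(i < size p) a i); apply/polyP=> k.
rewrite coef_map coef_poly /=; case: ltnP => [_|kp]; first by rewrite aP.
by rewrite rmorph0 nth_default.
Qed.

Section Roots.
Variables (n : nat) (s : n.-tuple L) (f : {poly A}).
Hypothesis sf : \prod_(z <- s) ('X - z%:P) = map_poly j f.

Let ev := meval (tnth s) \o map_mpoly j : {rmorphism {mpoly A[n]} -> L}.

Let evX i : ev 'X_i = tnth s i.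
Proof. by rewrite /ev /= map_mpolyX mevalXU. Qed.

(** The fundamental theorem on symmetric polynomials reduces this to the elementary ones, whose
    values are coefficients of [f] up to sign by Vieta. *)
Lemma symmetric_eval (p : {mpoly A[n]}) : p \is symmetric ->
  range j (map_mpoly j p).@[tnth s].
Proof.
move=> /sym_fundamental[t [<- _]].
rewrite map_mpoly_comp; last exact: fmorph_inj.
rewrite comp_mpoly_meval mevalE.
apply: subfield_sum => // m _; apply: subfieldM => //.
  by rewrite mcoeff_map_mpoly; exists t@_m.
elim/big_ind: _ => [||i _]; [exact: subfield1|exact: subfieldM|].
apply: subfieldX => //; rewrite tnth_map tnth_mktuple.
have -> : map_mpoly j (mesym n A i.+1) = mesym n L i.+1.
  rewrite /mesym rmorph_sum; apply: eq_bigr => h _; rewrite rmorph_prod.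
  by apply: eq_bigr => k _; rewrite /= map_mpolyX.
have := mroots_coeff s (lift ord0 i); rewrite lift0 sf coef_map /= => /esym h.
rewrite -[_.@[_]](signrMK i.+1) h.
by exists ((-1) ^+ i.+1 * f`_(n - i.+1)); rewrite // rmorphM rmorphXn rmorphN1.
Qed.

Lemma power_sum_range k : range j (\sum_(z <- s) z ^+ k).
Proof.
have /symmetric_eval : \sum_(i < n) ('X_i : {mpoly A[n]}) ^+ k \is symmetric.
  apply/issymP=> σ; rewrite rmorph_sum [RHS](reindex_inj (@perm_inj _ σ)) /=.
  by apply: eq_bigr => i _; rewrite rmorphXn /= /msym mmapX mmap1U.
rewrite -[_.@[_]]/(ev _) rmorph_sum big_tuple /=; congr (range j).
by apply: eq_bigr => i _; rewrite -evX -rmorphXn.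
Qed.

(** Laplace's resolvent, with one root [a + b + c%:R * a * b] for each unordered pair. Permuting the
    variables permutes the two-element sets [U], so its coefficients are symmetric. *)
Lemma pair_poly_range (c : nat) : exists g,
  \prod_(U : {set 'I_n} | #|U| == 2)
    ('X - (\sum_(i in U) tnth s i + c%:R * \prod_(i in U) tnth s i)%:P) =
  map_poly j g.
Proof.
pose P : {poly {mpoly A[n]}} := \prod_(U : {set 'I_n} | #|U| == 2)
    ('X - (\sum_(i in U) 'X_i + c%:R * \prod_(i in U) 'X_i)%:P).
have Psym k : P`_k \is symmetric.
  apply/issymP=> σ; rewrite -[LHS](coef_map (msym σ)).
  suff -> : map_poly (msym σ) P = P by [].
  rewrite rmorph_prod /P [RHS](reindex_inj (imset_inj (@perm_inj _ σ))) /=.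
  rewrite [RHS](eq_bigl (fun U : {set 'I_n} => #|U| == 2)) => [|U]; last first.
    by rewrite card_imset //; exact: perm_inj.
  apply: eq_bigr => U _; rewrite rmorphB /= map_polyX map_polyC /=.
  rewrite rmorphD rmorphM rmorph_nat rmorph_sum rmorph_prod /=.
  rewrite !big_imset /=; try by move=> ? ? _ _; exact: perm_inj.
  congr ('X - (_ + _ * _)%:P); apply: eq_bigr => i _;
    rewrite /msym mmapX mmap1U //.
apply: map_poly_range => k.
have -> : \prod_(U : {set 'I_n} | #|U| == 2)
    ('X - (\sum_(i in U) tnth s i + c%:R * \prod_(i in U) tnth s i)%:P) =
  map_poly ev P.
  rewrite rmorph_prod; apply: eq_bigr => U _.
  rewrite rmorphB /= map_polyX map_polyC /=.
  congr ('X - _%:P); rewrite -[RHS]/(ev _) rmorphD rmorphM rmorph_nat.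
  rewrite rmorph_sum rmorph_prod; congr (_ + _ * _).
    by apply: eq_bigr => i _; rewrite evX.
  by apply: eq_bigr => i _; rewrite evX.
by rewrite coef_map; exact: symmetric_eval.
Qed.

End Roots.
End SymmetricFunctions.

(** * Descent of sums of squares, and positive forms *)

Section Descent.
Variable L : fieldType.
Implicit Types A B : set L.

(** If [x] were not a sum of squares in [A], some semiordering of [A] would contain [- x]; its
    extension to [B] would contain [x] as well, whence [x = 0], which is a sum of squares. *)
Lemma totally_positive_sum_of_squares A B x : subfield A -> subfield B ->
  A `<=` B -> formally_real A -> totally_positive A B -> A x ->
  sum_of_squares B x -> sum_of_squares A x.
Proof.
move=> fA fB AB rA tAB Ax Bx; apply: contrapT => nAx.
have qA := sum_of_squares_qmodule fA rA.
have [||T sT QT] := qmodule_semiordering fA (qmodule_adjoin fA qA (x :=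
  - x) _ _).
- exact: subfieldN.
- by rewrite opprK.
have [T' [sT' T'A]] := tAB _ sT; have qT' := semiordering_qmodule fB sT'.
have T'nx : T' (- x).
  suff: T (- x) by rewrite -T'A => -[].
  apply: QT; exists 0, 1; rewrite mul1r add0r.
  by split=> //; [exact: sum_of_squares0|exact: sum_of_squares1].
have T'x : T' x.
  by have [_ T'1 _ _ _] := qT'; rewrite -(mulr1 x);
    exact: qmodule_sosM fB qT' Bx T'1.
apply: nAx; rewrite (qmodule_cap_opp fB qT' T'x T'nx).
exact: sum_of_squares0.
Qed.

Lemma sum_of_squares_divn A x m : subfield A -> formally_real A ->
  sum_of_squares A (x *+ m.+1) -> sum_of_squares A x.
Proof.
move=> fA rA Ax.
have m0 := qmodule_natf_neq0 m fA (sum_of_squares_qmodule fA rA).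
have -> : x = (m.+1%:R^-1) ^+ 2 * (x *+ m.+1 *+ m.+1).
  by rewrite -[x *+ _ *+ _]mulr_natr -[x *+ _]mulr_natr; field;
    rewrite addrC natr1.
apply: sum_of_squares_sqrM => //; first by apply: subfieldV => //;
  exact: subfield_nat.
elim: {2}m.+1 => [|k IHk]; first exact: sum_of_squares0.
by rewrite mulrSr; exact: sum_of_squaresD.
Qed.

Let form n (B : nat -> nat -> L) (x : nat -> L) :=
  \sum_(i < n) \sum_(k < n) B i k * x i * x k.

Let formS n (B : nat -> nat -> L) (x : nat ->
  L) : (forall i k, B i k = B k i) ->
  form n.+1 B x = B 0%N 0%N * x 0%N ^+ 2 + (x 0%N * \sum_(k < n) B 0%N k.+1 * x
    k.+1) *+ 2 +
    form n (fun i k => B i.+1 k.+1) (fun i => x i.+1).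
Proof.
move=> Bsym; rewrite /form !big_ord_recl.
under [X in _ + X]eq_bigr => i _ do rewrite big_ord_recl.
rewrite big_split /= mulr2n mulr_sumr addrA; congr (_ + _).
rewrite -!addrA; congr (_ + _); first by rewrite expr2 mulrA.
congr (_ + _); apply: eq_bigr => i _; first by rewrite mulrAC mulrC.
by rewrite Bsym mulrC.
Qed.

(* Completing squares over [A] writes the form as a sum of squares of linear
   forms over [A] with coefficients that are sums of squares in [A]. *)
Lemma psd_extension A B n (M : nat -> nat -> L) : subfield A -> subfield B ->
  A `<=` B -> formally_real A ->
  (forall i k, A (M i k)) -> (forall i k, M i k = M k i) ->
  (forall x : nat -> L, (forall i, A (x i)) ->
    sum_of_squares A (\sum_(i < n) \sum_(k < n) M i k * x i * x k)) ->
  forall y : nat -> L, (forall i, B (y i)) ->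
    sum_of_squares B (\sum_(i < n) \sum_(k < n) M i k * y i * y k).
Proof.
move=> fA fB AB rA.
have qA := sum_of_squares_qmodule fA rA.
have n2 : 2%:R != 0 :> L := qmodule_natf_neq0 1 fA qA.
elim: n M => [|n IHn] M MA Msym pM y yB.
  by rewrite big_ord0; exact: sum_of_squares0.
rewrite -/(form n.+1 M y).
have {}pM x : (forall i, A (x i)) ->
  sum_of_squares A (form n.+1 M x) by exact: pM.
pose cons t (x : nat -> L) i := if i is i'.+1 then x i' else t.
have consA t x : A t -> (forall i, A (x i)) -> forall i, A (cons t x i).
  by move=> At Ax [|i] /=.
(* With a zero diagonal entry the form is affine in the first variable, with slope [2 * l]. A
   nonzero [l] would let it take the value [-1] over [A]; so the first row vanishes. *)
have [c0|c0] := eqVneq (M 0%N 0%N) 0.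
  have lin0 (x : nat -> L) : (forall i, A (x i)) ->
    \sum_(k < n) M 0%N k.+1 * x k = 0.
    move=> xA; set l := \sum_(k < n) _; apply: contrapT => /eqP l0.
    have lA : A l by apply: subfield_sum => // k _; exact: subfieldM.
    pose r := form n (fun i k => M i.+1 k.+1) x.
    have rA' : A r.
      by apply: subfield_sum => // i _; apply: subfield_sum => // k _;
        apply: subfieldM => //; exact: subfieldM.
    have /pM : forall i, A (cons ((- 1 - r) / (l * 2%:R)) x i).
      apply: consA => //; apply: subfield_div => //.
        by apply: subfieldB => //; apply: subfieldN => //; exact: subfield1.
      by apply: subfieldM => //; exact: subfield_nat.
    rewrite formS // c0 mul0r add0r /= -/l -/r => h; apply: rA.
    suff <- : ((- 1 - r) / (l * 2) * l) *+ 2 + r = -1 by [].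
    by rewrite -mulr_natr; field; apply/andP.
  have M0 k : (k < n)%N -> M 0%N k.+1 = 0.
    move=> kn; have := lin0 (fun i : nat => (i == k)%:R) (fun i =>
      subfield_nat fA _).
    rewrite (bigD1 (Ordinal kn)) //= eqxx mulr1 big1 ?addr0 // => i ik.
    suff /negPf -> : (i != k :> nat)%N by rewrite mulr0.
    by apply: contraNneq ik => ik; exact/eqP/val_inj.
  rewrite formS // c0 mul0r add0r big1 ?mulr0 ?mul0rn ?add0r; last first.
    by move=> k _; rewrite M0 // mul0r.
  apply: (IHn (fun i k => M i.+1 k.+1)) => // x xA.
  have := pM _ (consA 0 x (subfield0 fA) xA).
  by rewrite formS // c0 mul0r add0r mul0r mul0rn add0r.
pose c := M 0%N 0%N; pose l (x : nat -> L) := \sum_(k < n) M 0%N k.+1 * x k.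
(* [M'] is the Schur complement of the entry [c]. *)
pose M' i k := M i.+1 k.+1 - M 0%N i.+1 * M 0%N k.+1 / c.
have square (x : nat -> L) t :
  form n.+1 M (cons t x) = c * (t + l x / c) ^+ 2 + form n M' x.
  rewrite formS //= -/(l x).
  have -> : form n M' x = form n (fun i k => M i.+1 k.+1) x - l x ^+ 2 / c.
    rewrite /form /M' expr2 /l mulr_suml mulr_suml -sumrB;
      apply: eq_bigr => i _.
    rewrite mulr_sumr mulr_suml -sumrB; apply: eq_bigr => k _.
    by ring.
  by rewrite -/c; field.
have sc : sum_of_squares A c.
  have /pM := consA 1 (fun=> 0) (subfield1 fA) (fun=> subfield0 fA).
  rewrite square /l big1 => [|k _]; last by rewrite mulr0.
  rewrite mul0r addr0 expr1n mulr1 /form big1 ?addr0 // => i _.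
  by rewrite big1 // => k _; rewrite mulr0.
have -> : form n.+1 M y = form n.+1 M (cons (y 0%N) (fun i => y i.+1)).
  by rewrite /form; apply: eq_bigr => -[[|i] ?] _;
    apply: eq_bigr => -[[|k] ?] _.
rewrite square; apply: sum_of_squaresD.
  rewrite mulrC; apply: sum_of_squares_sqrM => //; last first.
    exact: sum_of_squaresS AB _ sc.
  apply: subfieldD => //; apply: subfield_div => //; last exact/AB/MA.
  by apply: subfield_sum => // k _; apply: subfieldM => //; exact/AB/MA.
apply: IHn => //.
- move=> i k; apply: subfieldB => //; apply: subfield_div => //; last exact: MA.
  exact: subfieldM.
- by move=> i k; rewrite /M' Msym [M 0%N i.+1 * _]mulrC.
move=> x xA; have lA : A (l x).
  by apply: subfield_sum => // k _; exact: subfieldM.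
(* This first coordinate makes the completed square vanish, so [M'] inherits positivity over [A]. *)
have /pM : forall i, A (cons (- (l x / c)) x i).
  by apply: consA => //; apply: subfieldN => //; apply: subfield_div => //;
    exact: MA.
by rewrite square addNr expr0n mulr0 add0r.
Qed.

End Descent.

(** * Laplace's argument for the existence of roots *)

Section Laplace.
Variables (A L : fieldType) (j : {rmorphism A -> L}) (K : set L).
Hypothesis fK : subfield K.
Hypothesis char0 : forall m, m.+1%:R != 0 :> L.
Hypothesis odd_root : forall p : {poly A}, p != 0 -> ~~ odd (size p) ->
  exists a, root p a.
Hypothesis sqrt_closed : forall y, K y -> range j (y ^+ 2) -> range j y.

Let fj := subfield_range j.

(** The two combinations determine [a * b] and [a + b], so the discriminant [(a - b) ^+ 2] lies in
    [range j]; [sqrt_closed] gives [a - b], hence [a]. *)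
Let pair_range n (s : n.-tuple L) (U : {set 'I_n}) (c d : nat) :
  (forall z, z \in s -> K z) -> #|U| == 2 -> (c < d)%N ->
  range j (\sum_(i in U) tnth s i + c%:R * \prod_(i in U) tnth s i) ->
  range j (\sum_(i in U) tnth s i + d%:R * \prod_(i in U) tnth s i) ->
  exists2 z, z \in s & range j z.
Proof.
move=> sK /cards2P[x [y [xy ->]]] cd.
rewrite !big_setU1 ?inE //= !big_set1.
have := mem_tnth x s; have := mem_tnth y s.
move: (tnth s x) (tnth s y) => a b bs as_ jc jd; exists a => //.
have n2 : 2%:R != 0 :> L := char0 1.
have [m dE] : exists m, d = (c + m.+1)%N by exists (d - c).-1; lia.
have jab : range j (a * b).
  have -> : a * b = (a + b + d%:R * (a * b) - (a + b + c%:R * (a * b))) /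
    m.+1%:R.
    rewrite dE natrD; field; rewrite addrC natr1; exact: char0.
  by apply: subfield_div => //; [exact: subfieldB|exact: subfield_nat].
have jaDb : range j (a + b).
  rewrite -(addrK (c%:R * (a * b)) (a + b)); apply: subfieldB => //.
  by apply: subfieldM => //; exact: subfield_nat.
have jaBb : range j (a - b).
  apply: sqrt_closed; first by apply: subfieldB => //; exact: sK.
  have -> : (a - b) ^+ 2 = (a + b) ^+ 2 - 4%:R * (a * b) by ring.
  apply: subfieldB => //; first exact: subfieldX.
  by apply: subfieldM => //; exact: subfield_nat.
have -> : a = (a + b + (a - b)) / 2%:R by field.
by apply: (subfield_div fj); [exact: subfieldD|exact: subfield_nat].
Qed.

(* Laplace's induction on the 2-adic valuation of the degree. *)
Let root_in_range k m (s : seq L) (f : {poly A}) :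
  size s = (2 ^ k * m)%N -> odd m -> (forall z, z \in s -> K z) ->
  \prod_(z <- s) ('X - z%:P) = map_poly j f -> exists2 z, z \in s & range j z.
Proof.
elim: k m s f => [|k IHk] m s f sz om sK sf.
  have szf : size f = (size s).+1
    by rewrite -(size_map_poly j) -sf size_prod_XsubC.
  have [||a fa] := odd_root (p := f).
  - by rewrite -size_poly_eq0 szf.
  - by rewrite szf sz mul1n /= om.
  exists (j a); last by exists a.
  by rewrite -root_prod_XsubC sf fmorph_root.
pose N := size s; pose t : N.-tuple L := in_tuple s.
pose val_ (c : nat) (U : {set 'I_N}) :=
  \sum_(i in U) tnth t i + c%:R * \prod_(i in U) tnth t i.
have /boolp.choice[U UP] (c : nat) : exists U :
  {set 'I_N}, #|U| == 2 /\ range j (val_ c U).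
  have [g gE] := pair_poly_range (s := t) sf c.
  (* There are [N * (N - 1) / 2] pairs, that is [2 ^ k] times the odd number
     [m * (2 ^ k.+1 * m - 1)]: one factor 2 fewer than in [N]. *)
  have [||||z /mapP[U]] := IHk (m * (2 ^ k * m).*2.-1)%N
    [seq val_ c U | U <- enum [set U : {set 'I_N} | #|U| == 2]%SET] g.
  - rewrite size_map -cardE card_draws card_ord bin2 /N sz expnS -mulnA mul2n.
    by rewrite -[(_.*2 * _)%N]doubleMl half_double -doubleMl.
  - rewrite oddM om; case: m om sz => // m _ _.
    by rewrite -(@prednK (2 ^ k * m.+1)) ?muln_gt0 ?expn_gt0 // doubleS /=
      odd_double.
  - move=> _ /mapP[U _ ->]; apply: (subfieldD fK) => //.
      elim/big_ind: _ => [||i _];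
        [exact: (subfield0 fK)|exact: (subfieldD fK)|].
      exact/sK/mem_tnth.
    apply: (subfieldM fK) => //; first exact: (subfield_nat fK).
    elim/big_ind: _ => [||i _]; [exact: (subfield1 fK)|exact: (subfieldM fK)|].
    exact/sK/mem_tnth.
  - rewrite big_map big_enum -gE; apply: eq_bigl => U; rewrite inE //.
  by rewrite mem_enum inE => U2 -> zj; exists U.
(* The parameters [c] outnumber the subsets of ['I_N], so two of them select the same pair. *)
pose u (c : 'I_(#|{set 'I_N}|.+1)) := U c.
have /injectivePn[c [d cd ucd]] : ~~ injectiveb u.
  by apply/injectiveP => /leq_card; rewrite card_ord ltnn.
wlog {cd} cd : c d ucd / (c < d)%N.
  move: cd; rewrite neq_ltn => /orP[cd|dc] H; [exact: (H c d)|exact: (H d c)].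
have [U2 jc] := UP c; have [_ jd] := UP d.
apply: (pair_range (s := t) sK U2 cd jc).
by move: jd; rewrite -/(u d) -ucd.
Qed.

(** A root in [range j] gives a linear factor of [f] over [A]; dividing it out leaves one root
    fewer. *)
Lemma roots_in_range (s : seq L) (f : {poly A}) :
  (forall z, z \in s -> K z) -> \prod_(z <- s) ('X - z%:P) = map_poly j f ->
  forall z, z \in s -> range j z.
Proof.
have [n] := ubnP (size s); elim: n => // n IHn in s f *;
  rewrite ltnS => sn sK sf.
have [->//|s0] := eqVneq s [::].
have [|m om szs] := @pfactor_coprime 2 (size s) isT; first by case: (s) s0.
have [||z zs [a _ az]] := @root_in_range (logn 2 (size s)) m s f _ _ sK sf.
- by rewrite [LHS]szs mulnC.
- by rewrite -coprime2n.
have /dvdpP[q fE] : 'X - a%:P %| f.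
  by rewrite dvdp_XsubCl -(fmorph_root j) -sf root_prod_XsubC az.
move=> w; rewrite (perm_mem (perm_to_rem zs)) inE => /orP[/eqP->|ws].
  by exists a.
apply: (IHn (rem z s) q) ws.
- by rewrite (leq_trans _ sn) // (size_rem zs) prednK //; case: (s) s0.
- by move=> y /mem_rem; exact: sK.
have Xz0 : 'X - z%:P != 0 by rewrite polyXsubC_eq0.
apply: (mulIf Xz0); move: sf;
  rewrite (perm_big _ (perm_to_rem zs)) big_cons mulrC => ->.
by rewrite fE rmorphM rmorphB /= map_polyX map_polyC /= az.
Qed.

End Laplace.

(** * Squares from the Galois extension and the Hermite form *)

Section Galois.
Variables (F L : fieldType) (iota : {rmorphism F -> L}) (K : set L).
Hypothesis gK : galois_ext iota K.

(** [algebraicOver] supplies some nonzero polynomial, whereas [galois_ext] speaks of irreducible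
    ones. *)
Lemma algebraic_irreducible y : algebraicOver iota y ->
  exists2 p : {poly F}, irreducible_poly p & root (map_poly iota p) y.
Proof.
case=> p; have [n] := ubnP (size p); elim: n => // n IHn in p *.
rewrite ltnS => pn p0 py.
have p1 : (1 < size p)%N.
  rewrite ltnNge; apply/negP => p1; move: p0 py; rewrite (size1_polyC p1).
  by rewrite polyC_eq0 map_polyC rootC fmorph_eq0 => /negPf->.
have [irr_p|] := pselect (irreducible_poly p); first by exists p.
move=> nirr; have [q [q1 qp nqp]] : exists q :
  {poly F}, [/\ size q != 1, q %| p & ~~ (q %= p)].
  apply: contrapT => nq; apply: nirr; split=> // q q1 qp.
  by apply: contrapT => /negP nqp; apply: nq; exists q.
have [r pE] := dvdpP _ _ qp.
have /andP[r0 q0] : (r != 0) && (q != 0) by rewrite -negb_or -mulf_eq0 -pE.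
have qn : (size q < size p)%N.
  by rewrite ltn_neqAle dvdp_leq // andbT dvdp_size_eqp.
have rn : (size r < size p)%N.
  have sz : forall a b c, (a = (b + c).-1 -> c != 1 -> c != 0 -> b != 0 ->
    b < a)%N by lia.
  by apply: sz (q1) _ _; rewrite ?pE ?size_mul // size_poly_eq0.
move: py; rewrite pE rmorphM rootM => /orP[ry|qy].
  exact: IHn (leq_trans rn pn) r0 ry.
exact: IHn (leq_trans qn pn) q0 qy.
Qed.

(** Dividing by the leading coefficient turns the relation [%=] of normality into an equality of
    monic polynomials. *)
Lemma galois_split y : K y -> exists (rs : seq L) (f : {poly F}),
  [/\ forall r, r \in rs -> K r, y \in rs,
      \prod_(r <- rs) ('X - r%:P) = map_poly iota f & separable_poly f].
Proof.
have [_ algK normK sepK] := gK => Ky.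
have [p irr_p py] := algebraic_irreducible (algK _ Ky).
have [rs rsK prs] := normK _ _ irr_p Ky py.
have p0 := irredp_neq0 irr_p;
  have lp0 : lead_coef p != 0 by rewrite lead_coef_eq0.
have pf : (lead_coef p)^-1 *: p %= p by rewrite eqp_scale ?invr_eq0.
exists rs, ((lead_coef p)^-1 *: p); split=> //.
- by rewrite -root_prod_XsubC -(eqp_root prs).
- apply/esym/eqP; rewrite -eqp_monic.
  + by apply: eqp_trans prs; rewrite eqp_map.
  + by rewrite monicE lead_coef_map lead_coefZ mulVf ?rmorph1.
  + exact: monic_prod_XsubC.
- by rewrite (eqp_separable pf); exact: sepK irr_p Ky py.
Qed.

Hypothesis sosK : forall x, range iota x -> sum_of_squares K x ->
  sum_of_squares (range iota) x.
Hypothesis rF : formally_real (range iota).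
Hypothesis fK : subfield K.

(* With [Y] congruent to [X] modulo [X^2 - y^2] and to [0] modulo the
   complementary factor of the minimal polynomial of [y], the Hermite form
   [Y |-> \sum_r Y(r)^2] over the conjugates [r] of [y] takes the value
   [2 y^2]; it is positive over [iota F], hence over [range j]. *)
Lemma sum_of_squares_sqr_galois (A : fieldType) (j : {rmorphism A -> L}) y :
  range iota `<=` range j -> formally_real (range j) ->
  K y -> range j (y ^+ 2) -> sum_of_squares (range j) (y ^+ 2).
Proof.
move=> Fj rj Ky [a _ ay].
have fj := subfield_range j; have fF := subfield_range iota.
have [jy|njy] := pselect (range j y); first exact: sum_of_squares_sqr.
have [rs [f [rsK yrs fE sep_f]]] := galois_split Ky.
have [fA fAE] : exists fA, map_poly iota f = map_poly j fA.
  by apply: map_poly_range => k; apply: Fj; rewrite coef_map; exists f`_k.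
have sep_fA : separable_poly fA.
  by rewrite -(separable_map j) -fAE separable_map.
have irr_g : irreducible_poly ('X^2 - a%:P).
  apply: cubic_irreducible; first by rewrite size_XnsubC.
  move=> b; apply/negP; rewrite rootE !hornerE subr_eq0 => /eqP ba; apply: njy.
  have /eqP : j b ^+ 2 = y ^+ 2 by rewrite -ay -ba rmorphXn.
  rewrite eqf_sqr => /orP[]/eqP jb; first by exists b.
  by exists (- b); rewrite // rmorphN jb opprK.
have gE z : (map_poly j ('X^2 - a%:P)).[z] = z ^+ 2 - y ^+ 2.
  by rewrite rmorphB /= map_polyXn map_polyC /= ay !hornerE.
have gy : root (map_poly j ('X^2 - a%:P)) y by rewrite rootE gE subrr.
have fAy : root (map_poly j fA) y by rewrite -fAE -fE root_prod_XsubC.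
have /dvdpP[h hE] := irreducible_root_dvdp irr_g gy fAy.
(* Separability makes the factors [h] and ['X^2 - a%:P] of [fA] coprime, so [u * h] is 1 at the
   roots of the second and 0 at the other roots of [fA]. *)
move: sep_fA; rewrite hE separable_mul =>
  /and3P[_ _ /Bezout_eq1_coprimepP[[u v] /= uv]].
have {}uv z : (map_poly j u).[z] * (map_poly j h).[z] +
    (map_poly j v).[z] * (z ^+ 2 - y ^+ 2) = 1.
  by rewrite -gE -!hornerM -!rmorphM -hornerD -rmorphD uv rmorph1 hornerC.
pose Y := 'X * (u * h).
have YE r : r \in rs ->
    (map_poly j Y).[r] ^+ 2 = if r ^+ 2 == y ^+ 2 then y ^+ 2 else 0.
  rewrite -root_prod_XsubC fE fAE hE rmorphM rootM {2}/root gE subr_eq0 => rr.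
  rewrite /Y rmorphM /= map_polyX !hornerE rmorphM hornerM /=.
  case: eqP rr => [ry _|_]; last first.
    by rewrite orbF => /rootP ->; rewrite !mulr0 expr0n.
  by have := uv r; rewrite ry subrr mulr0 addr0 => ->; rewrite mulr1.
(* The Hermite form in the coefficients of a polynomial; its matrix consists of power sums of the
   roots, which lie in [range iota]. *)
pose form n (c : nat -> L) :=
  \sum_(i < n) \sum_(k < n) (\sum_(r <- rs) r ^+ (i + k)) * c i * c k.
have formE n c : form n c = \sum_(r <- rs) (\sum_(i < n) c i * r ^+ i) ^+ 2.
  rewrite /form; under [RHS]eq_bigr => r _ do
    (rewrite expr2 mulr_suml; under eq_bigr => i _ do rewrite mulr_sumr).
  rewrite [RHS]exchange_big; apply: eq_bigr => i _.
  rewrite [RHS]exchange_big; apply: eq_bigr => k _.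
  rewrite !mulr_suml; apply: eq_bigr => r _.
  by rewrite exprD; ring.
have BF i k : range iota (\sum_(r <- rs) r ^+ (i + k)).
  exact: (power_sum_range (s := in_tuple rs) fE).
have posF n c : (forall i, range iota (c i)) ->
  sum_of_squares (range iota) (form n c).
  move=> cF; apply: sosK.
    apply: subfield_sum => // i _; apply: subfield_sum => // k _.
    by apply: subfieldM => //; exact: subfieldM.
  rewrite formE; exists [seq \sum_(i < n) c i * r ^+ i | r <- rs].
  rewrite big_map; split=> // _ /mapP[r rrs ->]; have [FK _ _ _] := gK.
  apply: subfield_sum => // i _; apply: subfieldM => //; first exact: FK.
  by apply: subfieldX => //; exact: rsK.
have sosY : sum_of_squares (range j) (form (size Y) (fun i => j Y`_i)).
  apply: (psd_extension fF fj Fj rF BF _ (posF _)) => [i k|i].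
    by apply: eq_bigr => r _; rewrite addnC.
  by exists Y`_i.
move: sosY; rewrite formE.
(* Only the conjugates with [r ^+ 2 = y ^+ 2] contribute. As [y] is one of them, the multiplicity is
   positive and can be divided out. *)
have -> : \sum_(r <- rs) (\sum_(i < size Y) j Y`_i * r ^+ i) ^+ 2 =
    y ^+ 2 *+ count (fun r => r ^+ 2 == y ^+ 2) rs.
  rewrite big_seq.
  rewrite (eq_bigr (fun r => if r ^+ 2 == y ^+ 2 then y ^+ 2 else 0)) =>
    [|r rrs].
    by rewrite -big_seq -big_mkcond big_const_seq iter_addr addr0.
  rewrite -(YE r rrs) horner_coef size_map_poly; congr (_ ^+ 2).
  by apply: eq_bigr => i _; rewrite coef_map.
have : (0 < count (fun r => r ^+ 2 == y ^+ 2) rs)%N.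
  by rewrite -has_count; apply/hasP; exists y.
by case: count => // m _; exact: sum_of_squares_divn.
Qed.

End Galois.


Theorem theorem1p1 (F : fieldType) (Fal : closedFieldType)
    (iota : {rmorphism F -> Fal}) (K : set Fal) :
  (forall x : Fal, algebraicOver iota x) ->
  subfield K ->
  formally_real (range iota) ->
  formally_real K ->
  galois_ext iota K ->
  totally_positive (range iota) K ->
  totally_positive (pyclosure (range iota)) (pyclosure K).
Proof.
move=> _ fK rF _ gK tFK S sS.
have fF := subfield_range iota; have [FK _ _ _] := gK.
have fP := pyclosure_subfield (range iota); have fQ := pyclosure_subfield K.
have sub_py (E : set Fal) : E `<=` pyclosure E by move=> x Ex M [_]; exact.
have PQ : pyclosure (range iota) `<=` pyclosure K.
  by move=> x Px M [Mp KM]; apply: Px; split=> // z /FK/KM.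
apply: semiordering_ext => //.
have qS := semiordering_qmodule fP sS; have [SP S1 _ _ nS1] := qS.
have nSP : ~ qspan S (pyclosure (range iota)) (-1).
  by move=> /(sub_qspanT fP qS (fun x => id)).
have [M [fM PM nSM maxM]] := max_subfield fP nSP.
have [A [j Mj]] := subfieldP fM; rewrite Mj {M Mj} in fM PM nSM maxM.
have Sj : S `<=` range j by move=> x /SP/PM.
have qj := qspan_qmodule fM Sj S1 nSM.
have py_j := max_pythagorean Sj S1 nSM maxM.
(* Sums of squares lie in the module generated by [S], which omits [-1]. *)
have rj : formally_real (range j).
  have [_ _ _ _ nq] := qj; move=> sn1; apply: nq.
  rewrite -[-1]mulr1; apply: qmodule_sosM sn1 _ => //; exact: sub_qspan.
have Fj : range iota `<=` range j by move=> x /sub_py/PM.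
have sosK x : range iota x -> sum_of_squares K x ->
  sum_of_squares (range iota) x.
  exact: totally_positive_sum_of_squares.
have sqrt_closed y : K y -> range j (y ^+ 2) -> range j y.
  move=> Ky jy2.
  have [z jz /eqP] := py_j _ (sum_of_squares_sqr_galois gK sosK rF fK Fj rj Ky
    jy2).
  rewrite eqf_sqr => /orP[]/eqP-> //; exact: subfieldN.
have Kj : K `<=` range j.
  move=> x Kx; have [rs [f [rsK xrs fE _]]] := galois_split gK Kx.
  have [fA fAE] : exists fA, map_poly iota f = map_poly j fA.
    by apply: map_poly_range => k; apply: Fj; rewrite coef_map; exists f`_k.
  apply: (roots_in_range fK _ _ sqrt_closed rsK _ xrs); last by rewrite fE fAE.
    by move=> m; exact: qmodule_natf_neq0 fM qj.
  exact: max_odd_root Sj S1 nSM maxM.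
(* As a pythagorean subfield containing [K], [range j] contains [pyclosure K], so a relation for
   [-1] over the latter would hold over [range j]. *)
move=> Sn1; apply: nSM; apply: qspanS Sn1 => x; apply.
by split.
Qed.
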